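(* Let $\bm u(\bm x,t)$ and $\bm\alpha(\bm x,t)$ be sufficiently smooth vector fields on $\mathbb R^d$ and let $W_t$ be a scalar standard Brownian motion. Set $\bm L=\nabla\bm u$, $\bm A=\nabla\bm\alpha$, $\bm D_u=\tfrac12(\bm L+\bm L^{\mathsf T})$, $\bm D_\alpha=\tfrac12(\bm A+\bm A^{\mathsf T})$, $\bm W_\alpha=\tfrac12(\bm A-\bm A^{\mathsf T})$, and let the local relative deformation be $\bm F=\bm I+\bm A\,\mathrm dW_t+\bm L\,\mathrm dt$, considered before it loses orientation (i.e. while $\det\bm F>0$). Then, through order $\mathrm dt$, the material Hencky increment $\mathrm d\bm H=\tfrac12\log(\bm F^{\mathsf T}\bm F)$ and the spatial Hencky increment $\mathrm d\bm h=\tfrac12\log(\bm F\bm F^{\mathsf T})$ are $$\mathrm d\bm H=\bm D_\alpha\,\mathrm dW_t+\left(\bm D_u+\tfrac12\bm A^{\mathsf T}\bm A-\bm D_\alpha^2\right)\mathrm dt,$$ $$\mathrm d\bm h=\bm D_\alpha\,\mathrm dW_t+\left(\bm D_u+\tfrac12\bm A\bm A^{\mathsf T}-\bm D_\alpha^2\right)\mathrm dt.$$ Moreover, with the quadratic drift corrections $\bm Q_H=\tfrac12\bm A^{\mathsf T}\bm A-\bm D_\alpha^2$ and $\bm Q_h=\tfrac12\bm A\bm A^{\mathsf T}-\bm D_\alpha^2$, $$\bm Q_h-\bm Q_H=\tfrac12(\bm A\bm A^{\mathsf T}-\bm A^{\mathsf T}\bm A)=\bm W_\alpha\bm D_\alpha-\bm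 D_\alpha\bm W_\alpha,$$ and this difference is symmetric and trace free, and vanishes when $\bm A$ is normal.
   Context: The stochastic particle map is $\mathrm d\bm x_t=\bm u(\bm x_t,t)\,\mathrm dt+\bm\alpha(\bm x_t,t)\,\mathrm dW_t$ (Itô). Gradients use the convention $(\nabla\bm u)_{ij}=\partial_j u_i$. ''Through order $\mathrm dt$'' means computing with the Itô multiplication rules $\mathrm dW_t\,\mathrm dW_t=\mathrm dt$, $\mathrm dW_t\,\mathrm dt=0$, $\mathrm dt\,\mathrm dt=0$, and discarding terms of order $o(\mathrm dt)$; $\log$ is the principal logarithm of a symmetric positive definite matrix. The increments are local ones, starting from the undeformed state $\bm F=\bm I$ with $\bm A,\bm L$ evaluated at the current point and time. *)

(* Defs.v *)
From HB Require Import structures.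
From mathcomp Require Import all_boot all_order all_algebra.
From mathcomp Require Import all_classical all_reals all_analysis.

Set Implicit Arguments.
Unset Strict Implicit.
Unset Printing Implicit Defensive.

Import Order.TTheory GRing.Theory Num.Theory.
Import numFieldNormedType.Exports.

Local Open Scope classical_set_scope.
Local Open Scope ring_scope.

(* Points of R^d are row vectors, on which ['J f x] acts on the right:
   its (i, j) entry is the i-th partial derivative of the j-th component of f.
   The transpose gives (grad f x) i j = d_j f_i. *)
Definition grad (R : realType) (d : nat) (f : 'rV[R]_d -> 'rV[R]_d)
    (x : 'rV[R]_d) : 'M[R]_d :=
  ('J f x)^T.

Definition sym_part (R : realType) (d : nat) (M : 'M[R]_d) : 'M[R]_d :=
  2^-1 *: (M + M^T).

Definition skew_part (R : realType) (d : nat) (M : 'M[R]_d) : 'M[R]_d :=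
  2^-1 *: (M - M^T).

(* The principal logarithm of a symmetric positive definite matrix S, by
   functional calculus: an orthogonal diagonalization of S with positive
   eigenvalues is kept, and each eigenvalue is replaced by its logarithm.  The
   result does not depend on the diagonalization. *)
Definition is_mxlog (R : realType) (d : nat) (S H : 'M[R]_d) : Prop :=
  exists (Q : 'M[R]_d) (l : 'rV[R]_d),
    [/\ Q *m Q^T = 1%:M, forall i, 0 < l 0 i,
        S = Q^T *m diag_mx l *m Q &
        H = Q^T *m diag_mx (map_mx (@ln R) l) *m Q].

(* Junk value 0 when S is not symmetric positive definite. *)
Definition mxlog (R : realType) (d : nat) (S : 'M[R]_d) : 'M[R]_d :=
  xget 0 [set H | is_mxlog S H].

(* Time is [0, +oo[; the values W t with t < 0 are unconstrained. *)
Record brownian_motion (R : realType) (disp : measure_display)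
    (T : measurableType disp) (P : probability T R) (W : R -> T -> R) : Prop :=
  BrownianMotion {
    bm_measurable : forall t : R, 0 <= t -> measurable_fun [set: T] (W t) ;
    bm_start : {ae P, forall w, W 0 w = 0} ;
    bm_gaussian : forall s t : R, 0 <= s -> s < t ->
      forall B : set R, measurable B ->
      P [set w | B (W t w - W s w)] = normal_prob 0 (Num.sqrt (t - s)) B ;
    bm_independent : forall (n : nat) (s : nat -> R) (B : nat -> set R),
      0 <= s 0%N -> (forall i, s i <= s i.+1) -> (forall i, measurable (B i)) ->
      P [set w | forall i, (i < n)%N -> B i (W (s i.+1) w - W (s i) w)] =
      (\prod_(i < n) fine (P [set w | B i (W (s i.+1) w - W (s i) w)]))%:E ;
    bm_continuous :
      {ae P, forall w, {within `[0, +oo[, continuous (fun t => W t w)}} }.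

(* A family X of random matrices indexed by the time step h, considered on the
   events D h, is o(dt): E[min(|X_h|, 1); D h] = o(h) as h -> 0+.  Equivalently,
   E[|X_h|; D h \ N_h] = o(h) for some exceptional events N_h of probability
   o(h).  This is stronger than X_h / h -> 0 in probability. *)
Definition is_o_dt (R : realType) (disp : measure_display)
    (T : measurableType disp) (P : probability T R) (d : nat)
    (D : R -> set T) (X : R -> T -> 'M[R]_d) : Prop :=
  ((h^-1)%:E * \int[P]_(w in D h) (Num.min `|X h w| 1)%:E)%E @[h --> 0^'+] --> 0%E.

(* X = a dW + b dt through order dt, where dW h is the increment of the Brownian
   motion over a time step dt = h: the difference is a combination of the
   expressions dW dW - dt, dW dt, dt dt that the Ito multiplication rules set to
   0, up to o(dt).  The term dW dW - dt has to be listed, being of size h and not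
   o(h); it is centered and independent of the past, so that summing over the
   steps of a subdivision makes it negligible.  The coefficients a, b are
   determined by X if P (D h) -> 1. *)
Definition eq_through_dt (R : realType) (disp : measure_display)
    (T : measurableType disp) (P : probability T R) (d : nat)
    (dW : R -> T -> R) (D : R -> set T) (X : R -> T -> 'M[R]_d)
    (a b : 'M[R]_d) : Prop :=
  exists K1 K2 K3 : 'M[R]_d,
    is_o_dt P D (fun h w => X h w - (dW h w *: a + h *: b)
      - ((dW h w * dW h w - h) *: K1 + (dW h w * h) *: K2 + (h * h) *: K3)).

(* Main.v *)
(* With dt = h = s^2 and y = dW, F^T F = I + E where E = 2 y D_alpha + O(rho^2) and
   rho = |y| + s. By functional calculus log (I + E) = E - E^2 / 2 + O(|E|^3), so the
   Hencky increment minus its claimed expansion is (dW^2 - dt) K1 + O(rho^3) with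
   K1 = A^T A / 2 - D_alpha^2, for every outcome with rho small. Where rho is not
   small, min(|X|, 1) <= 1 = O(rho^3) as well, whatever the value of the logarithm.
   Since y / s is standard Gaussian, E[rho^3] = O(s^3) = o(dt); the cubic moment is
   bounded through the Gaussian integral of exp (z^2 / 4). The spatial increment is
   the material one for A^T and L^T. *)

Require Import Defs.
From HB Require Import structures.
From mathcomp Require Import all_boot all_order all_algebra.
From mathcomp Require Import complex ring lra.
From mathcomp Require Import all_classical all_reals all_analysis.
From mathcomp Require Import measurable_realfun.

Set Implicit Arguments.
Unset Strict Implicit.
Unset Printing Implicit Defensive.

Import Order.TTheory GRing.Theory Num.Theory.
Import numFieldNormedType.Exports.

Local Open Scope classical_set_scope.
Local Open Scope ring_scope.

(** * Spectral theorem for real symmetric matrices *)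

(** Over the complex numbers [S] is Hermitian, so its spectral diagonal is real; a real root of the
    complexified characteristic polynomial is a root of the real one. *)
Lemma symmetric_eigenvalue (R : rcfType) n (S : 'M[R]_n.+1) :
  S^T = S -> exists a, eigenvalue S a.
Proof.
move=> Ssym; pose C := map_mx (real_complex R) S.
have CE : C = (-1) ^+ false *: map_mx Num.conj C^T.
  rewrite expr0 scale1r; apply/matrixP=> i j; rewrite !mxE -[in LHS]Ssym mxE.
  by apply/esym/CrealP/complex_realP; exists (S j i).
have Cherm : C \is hermitianmx _ false Num.conj by apply/is_hermitianmxP.
have /mxOverP/(_ 0 0)/RRe_real aE := hermitian_spectral_diag_real Cherm.
have := orthomx_spectralP (hermitian_normalmx Cherm).
move=> /(congr1 (mulmx (spectralmx C))).
rewrite !mulmxA mulmxV ?spectral_unit// mul1mx => PC.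
exists (complex.Re (spectral_diag C 0 0)).
rewrite eigenvalue_root_char -(fmorph_root (real_complex R)) map_char_poly.
rewrite /= aE -eigenvalue_root_char.
apply/eigenvalueP; exists (row 0 (spectralmx C)).
  by rewrite -row_mul PC mul_diag_mx; apply/rowP => j; rewrite !mxE.
(* If the first row of the invertible [spectralmx C] were zero, so would be the first row of the
   identity. *)
apply/eqP => /(congr1 (mulmx^~ (invmx (spectralmx C)))).
rewrite -row_mul mulmxV ?spectral_unit// mul0mx => /rowP/(_ 0).
by rewrite !mxE eqxx => /eqP; rewrite oner_eq0.
Qed.

Lemma mulmx11 (R : comPzRingType) m n (A : 'M[R]_(m, 1)) (B : 'M[R]_(1, 1))
    (C : 'M[R]_(1, n)) : A *m B *m C = B 0 0 *: (A *m C).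
Proof. by rewrite [B]mx11_scalar mul_mx_scalar -scalemxAl !mxE eqxx mulr1n. Qed.

(* Householder reflection exchanging [v] and the first basis vector. *)
Lemma orthogonal_first_row (R : realFieldType) n (v : 'rV[R]_n.+1) :
  v *m v^T = 1%:M -> exists2 U : 'M[R]_n.+1, U *m U^T = 1%:M & row 0 U = v.
Proof.
move=> vv; pose e : 'rV[R]_n.+1 := delta_mx 0 0.
have [->|vDe] := eqVneq v e.
  exists 1%:M; first by rewrite trmx1 mulmx1.
  by apply/rowP => i; rewrite !mxE eqxx eq_sym.
pose w := v - e; pose c : R := (w *m w^T) 0 0.
have c_neq0 : c != 0.
  rewrite /c mxE psumr_eq0 => [|i _]; last by rewrite !mxE -expr2 sqr_ge0.
  apply: contra vDe => /allP w0; rewrite -subr_eq0; apply/eqP/rowP => i.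
  have := w0 i (mem_index_enum _); rewrite /= /w !mxE mulf_eq0 orbb.
  by move=> /eqP.
have eMT (x : 'rV[R]_n.+1) : (e *m x^T) 0 0 = x 0 0.
  by rewrite -rowE !mxE.
have cE : c = 2 * (1 - v 0 0).
  have -> : c = (v *m v^T) 0 0 - (e *m v^T) 0 0
      - ((e *m v^T)^T 0 0 - (e *m e^T) 0 0).
    rewrite /c /w linearB /= mulmxBl !mulmxBr trmx_mul trmxK.
    move: (v *m v^T) (v *m e^T) (e *m v^T) (e *m e^T) => A B C D.
    rewrite !mxE !opprB -!addrA; congr (_ + _).
    by rewrite addrCA [in RHS]addrCA [- B _ _ + _]addrC.
  rewrite [(e *m v^T)^T 0 0]mxE !eMT vv !mxE !eqxx mulr1n; ring.
pose U := 1%:M - (2 / c) *: (w^T *m w).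
have UT : U^T = U by rewrite linearB linearZ /= trmx_mul trmxK trmx1.
have MM : (w^T *m w) *m (w^T *m w) = c *: (w^T *m w).
  by rewrite mulmxA -[w^T *m w *m _]mulmxA mulmx11.
exists U.
  rewrite UT /U; move: (w^T *m w) MM => M MM.
  rewrite mulmxBl mul1mx mulmxBr mulmx1 -scalemxAl -scalemxAr MM !scalerA.
  have -> : 2 / c * (2 / c) * c = 2 / c + 2 / c by field.
  by rewrite scalerDl opprB addrK subrK.
rewrite rowE -/e /U mulmxBr mulmx1 -scalemxAr mulmxA.
(* Since [v] and [e] are unit vectors, e w^T = v_0 - 1 = -c/2, whence e U = e + w = v. *)
have -> : e *m w^T = (- c / 2)%:M.
  rewrite [LHS]mx11_scalar eMT cE /w !mxE !eqxx mulr1n; congr _%:M; by field.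
rewrite mul_scalar_mx scalerA.
have -> : 2 / c * (- c / 2) = - 1 by field.
by rewrite scaleN1r opprK addrC subrK.
Qed.

(** Induction on the dimension: a unit eigenvector is completed to an orthogonal [U]; then U S U^T
    has first row a e_0, hence is block diagonal by symmetry, and the lower right block is
    diagonalized by induction. *)
Lemma symmetric_spectral (R : rcfType) n (S : 'M[R]_n) : S^T = S ->
  exists (Q : 'M[R]_n) (l : 'rV[R]_n),
    Q *m Q^T = 1%:M /\ S = Q^T *m diag_mx l *m Q.
Proof.
elim: n S => [|n IHn] S Ssym.
  by exists 1%:M, 0; split; apply/matrixP => -[].
have [a /eigenvalueP[v0 v0S v0_neq0]] := symmetric_eigenvalue Ssym.
pose k : R := (v0 *m v0^T) 0 0.
have k_gt0 : 0 < k.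
  have v0ge0 i : 0 <= v0 0 i * v0^T i 0 by rewrite !mxE -expr2 sqr_ge0.
  rewrite /k mxE lt0r sumr_ge0// andbT psumr_eq0//.
  apply: contra v0_neq0 => /allP v00; apply/eqP/rowP => i.
  have := v00 i (mem_index_enum _); rewrite /= !mxE mulf_eq0 orbb.
  by move=> /eqP.
pose v := (Num.sqrt k)^-1 *: v0.
have vS : v *m S = a *: v by rewrite -scalemxAl v0S !scalerA mulrC.
have /orthogonal_first_row[U UU Uv] : v *m v^T = 1%:M.
  rewrite /v linearZ /= -scalemxAl -scalemxAr scalerA [v0 *m _]mx11_scalar -/k.
  rewrite scale_scalar_mx -invfM -expr2 sqr_sqrtr ?ltW//.
  by rewrite mulVf// gt_eqF.
have UU' : U^T *m U = 1%:M by exact: mulmx1C.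
pose B : 'M[R]_(1 + n) := U *m S *m U^T.
have Bsym : B^T = B by rewrite /B !trmx_mul trmxK Ssym mulmxA.
have B0 : row 0 B = a *: delta_mx 0 0.
  rewrite /B !row_mul Uv vS -scalemxAl; congr (_ *: _).
  by rewrite -Uv -row_mul UU rowE mulmx1.
have Bur : ursubmx B = 0.
  apply/rowP => j; rewrite !mxE; move/rowP/(_ (rshift 1 j)): B0.
  have j0 : (rshift 1 j == 0 :> 'I_(1 + n)) = false by [].
  have l0 : lshift n 0 = 0 :> 'I_(1 + n) by exact: val_inj.
  by rewrite !mxE eqxx j0 mulr0 l0.
have Bdl : dlsubmx B = 0.
  by rewrite -[B]trmxK -trmx_ursub Bsym Bur trmx0.
have [Q [l [QQ Dl]]] : exists (Q : 'M[R]_n) (l : 'rV[R]_n),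
    Q *m Q^T = 1%:M /\ drsubmx B = Q^T *m diag_mx l *m Q.
  by apply: IHn; rewrite trmx_drsub Bsym.
pose D : 'M[R]_(1 + n) := block_mx 1%:M 0 0 Q.
have DT : D^T = block_mx 1%:M 0 0 Q^T by rewrite tr_block_mx !trmx0 trmx1.
have DD : D *m D^T = 1%:M.
  rewrite DT mulmx_block !mulmx0 !mul0mx !mul1mx !addr0 !add0r QQ.
  by rewrite -scalar_mx_block.
pose r : 'rV[R]_(1 + n) := row_mx (ulsubmx B) l.
have BE : B = D^T *m diag_mx r *m D.
  have ulE : diag_mx (ulsubmx B) = ulsubmx B.
    rewrite [X in diag_mx X]mx11_scalar [RHS]mx11_scalar -diag_const_mx.
    by congr diag_mx; apply/rowP => i; rewrite !mxE ord1 eqxx.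
  rewrite DT diag_mx_row !mulmx_block.
  rewrite !(mulmx0, mul0mx, addr0, add0r, mulmx1, mul1mx) -Dl ulE.
  by rewrite -[X in block_mx _ X]Bur -[X in block_mx _ _ X]Bdl submxK.
exists (D *m U), r; split.
  by rewrite trmx_mul mulmxA -[_ *m U *m _]mulmxA UU mulmx1.
have -> : S = U^T *m B *m U.
  by rewrite /B !mulmxA UU' mul1mx -mulmxA UU' mulmx1.
by rewrite BE trmx_mul !mulmxA.
Qed.

(** * Second-order Taylor bound for the scalar logarithm *)

(** The left-hand function vanishes at 0 and has derivative x^2 / (1 + x), so the mean value theorem
    supplies the third factor [|e|]. The constant 2 comes from 1 + x >= 1/2. *)
Lemma ln1_taylor2 (R : realType) (e : R) : `|e| <= 1 / 2 ->
  `|ln (1 + e) - e + e ^+ 2 / 2| <= 2 * `|e| ^+ 3.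
Proof.
move=> e_small.
pose f x : R := ln (1 + x) - x + x ^+ 2 / 2.
have f0 : f 0 = 0 by rewrite /f addr0 ln1 subr0 expr0n mul0r addr0.
have df (x : R) : `|x| <= 1 / 2 -> is_derive x (1 : R) f (x ^+ 2 / (1 + x)).
  move=> x_small; have x1 : 0 < 1 + x by move: x_small; rewrite ler_norml; lra.
  have dln : is_derive (1 + x) 1 (@ln R) (1 + x)^-1 by exact: is_derive1_ln.
  have dc : is_derive x (1 : R) (fun y : R => ln (1 + y)) ((1 + x)^-1).
    rewrite -[(1 + x)^-1]mulr1.
    apply: (is_derive1_comp (f := @ln R) (g := fun y : R => 1 + y)).
    by rewrite -[X in is_derive _ _ _ X]add0r; exact: is_deriveD.
  apply: is_derive_eq.
  rewrite !scaler1 scaler0 ?add0r /GRing.scale /=; field; lra.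
have bound c : `|c| <= `|e| -> `|c ^+ 2 / (1 + c)| <= 2 * `|e| ^+ 2.
  move=> ce; have c1 : 1 / 2 <= 1 + c.
    by move: (le_trans ce e_small); rewrite ler_norml; lra.
  have c1p : 0 < 1 + c by lra.
  rewrite normrM normfV normrX (gtr0_norm c1p) ler_pdivrMr//.
  have : `|c| ^+ 2 <= `|e| ^+ 2 by rewrite lerXn2r ?nnegrE.
  have := sqr_ge0 `|e|; nra.
rewrite -/(f e) -[f e]subr0 -f0.
have [e0|e0] := leP 0 e.
- move: (e_small); rewrite ler_norml => /andP[_ e_le].
  have [] := @MVT_segment _ f (fun x => x ^+ 2 / (1 + x)) 0 e e0.
  + by move=> x; rewrite in_itv /= => ?; apply: df; rewrite ler_norml; lra.
  + apply: derivable_within_continuous => x; rewrite in_itv /= => ?.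
    have [] // : is_derive x (1 : R) f (x ^+ 2 / (1 + x)).
    by apply: df; rewrite ler_norml; lra.
  move=> c; rewrite in_itv /= => ? ->.
  rewrite subr0 normrM [`|e| ^+ 3]exprSr mulrA.
  by rewrite ler_wpM2r//; apply: bound; rewrite !ger0_norm; lra.
- move: (e_small); rewrite ler_norml => /andP[e_ge _].
  have [] := @MVT_segment _ f (fun x => x ^+ 2 / (1 + x)) e 0 (ltW e0).
  + by move=> x; rewrite in_itv /= => ?; apply: df; rewrite ler_norml; lra.
  + apply: derivable_within_continuous => x; rewrite in_itv /= => ?.
    have [] // : is_derive x (1 : R) f (x ^+ 2 / (1 + x)).
    by apply: df; rewrite ler_norml; lra.
  move=> c; rewrite in_itv /= => ?; rewrite distrC => ->.
  rewrite sub0r normrM normrN [`|e| ^+ 3]exprSr mulrA.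
  by rewrite ler_wpM2r//; apply: bound; rewrite !ler0_norm; lra.
Qed.

(** * Maximum norm and second-order Taylor bound for the matrix logarithm *)

Lemma le_coord_mx_norm (R : realType) m n (A : 'M[R]_(m, n)) i j :
  `|A i j| <= `|A|.
Proof.
rewrite [leRHS]/Num.Def.normr /= mx_normrE.
exact: (le_bigmax _ (fun ij => `|A ij.1 ij.2|) (i, j)).
Qed.

Lemma mx_norm_le (R : realType) m n (A : 'M[R]_(m, n)) (c : R) :
  0 <= c -> (forall i j, `|A i j| <= c) -> `|A| <= c.
Proof.
move=> c0 Ac; rewrite [leLHS]/Num.Def.normr /= mx_normrE.
by apply: bigmax_le => // -[i j] _; exact: Ac.
Qed.

Lemma mx_norm_tr (R : realType) m n (A : 'M[R]_(m, n)) : `|A^T| = `|A|.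
Proof.
have le p q (B : 'M[R]_(p, q)) : `|B^T| <= `|B|.
  by apply: mx_norm_le => // i j; rewrite mxE le_coord_mx_norm.
by apply/eqP; rewrite eq_le le -{1}[A]trmxK le.
Qed.

(** The norm is the largest absolute entry, so it is submultiplicative only up to the inner
    dimension; this is the source of the powers of [d] below. *)
Lemma mx_normM (R : realType) m n p (A : 'M[R]_(m, n)) (B : 'M[R]_(n, p)) :
  `|A *m B| <= n%:R * (`|A| * `|B|).
Proof.
apply: mx_norm_le => [|i j]; first by rewrite !mulr_ge0.
rewrite mxE (le_trans (ler_norm_sum _ _ _))//.
rewrite -[n in n%:R]card_ord mulr_natl -sumr_const.
apply: ler_sum => k _.
by rewrite normrM ler_pM ?le_coord_mx_norm.
Qed.

Lemma orthogonal_norm (R : realType) d (Q : 'M[R]_d) :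
  Q *m Q^T = 1%:M -> `|Q| <= 1.
Proof.
move=> QQ; apply: mx_norm_le => // i j.
have : (Q *m Q^T) i i = 1 by rewrite QQ mxE eqxx.
rewrite mxE (bigD1 j)//= mxE -expr2 => QE.
rewrite -(@ler_pXn2r _ 2)// ?nnegrE// expr1n -normrX ger0_norm ?sqr_ge0//.
by rewrite -QE lerDl sumr_ge0// => k _; rewrite mxE -expr2 sqr_ge0.
Qed.

Lemma orthogonal_conj_norm (R : realType) d (Q E : 'M[R]_d) :
  Q *m Q^T = 1%:M -> `|Q *m E *m Q^T| <= d%:R ^+ 2 * `|E|.
Proof.
move=> /orthogonal_norm Q1; have QT1 : `|Q^T| <= 1 by rewrite mx_norm_tr.
rewrite (le_trans (mx_normM _ _))// expr2 -mulrA ler_wpM2l//.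
have := mx_normM Q E => /le_trans QE.
rewrite -[leRHS]mulr1 ler_pM// QE// ler_wpM2l//.
by rewrite -[leRHS]mul1r ler_pM.
Qed.

Lemma norm_diag_mx (R : realType) d (l : 'rV[R]_d) (c : R) :
  0 <= c -> (forall i, `|l 0 i| <= c) -> `|diag_mx l| <= c.
Proof.
move=> c0 lc; apply: mx_norm_le => // i j; rewrite mxE.
by case: eqP => _; rewrite ?mulr1n ?mulr0n ?normr0.
Qed.

Lemma diag_mx_eigen (R : realType) d (Q E : 'M[R]_d) (l : 'rV[R]_d) :
  Q *m Q^T = 1%:M -> 1%:M + E = Q^T *m diag_mx l *m Q ->
  E = Q^T *m diag_mx (l - const_mx 1) *m Q /\
  forall i, `|l 0 i - 1| <= d%:R ^+ 2 * `|E|.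
Proof.
move=> QQ SE; have QQ' := mulmx1C QQ.
have EE : E = Q^T *m diag_mx (l - const_mx 1) *m Q.
  rewrite linearB /= diag_const_mx mulmxBr mulmxBl -SE mulmx1 QQ'.
  by rewrite addrAC subrr add0r.
split=> // i; rewrite (le_trans _ (orthogonal_conj_norm E QQ))//.
have <- : (Q *m E *m Q^T) i i = l 0 i - 1.
  by rewrite EE !mulmxA QQ mul1mx -mulmxA QQ mulmx1 !mxE eqxx.
exact: le_coord_mx_norm.
Qed.

Lemma is_mxlog_taylor2 (R : realType) d (E H : 'M[R]_d) :
  d%:R ^+ 2 * `|E| <= 1 / 2 -> is_mxlog (1%:M + E) H ->
  `|H - E + 2^-1 *: (E *m E)| <= 2 * d%:R ^+ 8 * `|E| ^+ 3.
Proof.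
move=> Esmall [Q [l [QQ l_gt0 SE HE]]].
have [EE le] := diag_mx_eigen QQ SE.
set e := l - const_mx 1 in EE.
pose g := \row_i (ln (l 0 i) - (l 0 i - 1) + (l 0 i - 1) ^+ 2 / 2).
have -> : H - E + 2^-1 *: (E *m E) = Q^T *m diag_mx g *m Q.
  have -> : E *m E = Q^T *m diag_mx (\row_i (e 0 i * e 0 i)) *m Q.
    by rewrite {1 2}EE !mulmxA -[_ *m Q *m Q^T]mulmxA QQ mulmx1
      -[_ *m diag_mx _ *m diag_mx _]mulmxA mulmx_diag.
  rewrite HE {1}EE -mulmxBl -mulmxBr -linearB /=.
  rewrite scalemxAl scalemxAr -linearZ /= -mulmxDl -mulmxDr -linearD /=.
  congr (_ *m diag_mx _ *m _); apply/rowP => i.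
  by rewrite /e !mxE expr2 [2^-1 * _]mulrC.
rewrite -[X in _ *m X]trmxK.
have QQT : Q^T *m Q^T^T = 1%:M by rewrite trmxK (mulmx1C QQ).
apply: le_trans (orthogonal_conj_norm _ QQT) _.
have -> : 2 * d%:R ^+ 8 * `|E| ^+ 3 =
    d%:R ^+ 2 * (2 * (d%:R ^+ 2 * `|E|) ^+ 3) :> R.
  by ring.
rewrite ler_wpM2l ?exprn_ge0//; apply: norm_diag_mx => [|i].
  by rewrite mulr_ge0// exprn_ge0// mulr_ge0// exprn_ge0.
rewrite mxE; have -> : ln (l 0 i) = ln (1 + (l 0 i - 1)) by rewrite addrC subrK.
apply: le_trans (ln1_taylor2 (le_trans (le i) Esmall)) _.
by rewrite ler_wpM2l// lerXn2r ?nnegrE// mulr_ge0// exprn_ge0.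
Qed.

Lemma mxlog_taylor2 (R : realType) d (E : 'M[R]_d) :
  E^T = E -> d%:R ^+ 2 * `|E| <= 1 / 2 ->
  `|mxlog (1%:M + E) - E + 2^-1 *: (E *m E)| <= 2 * d%:R ^+ 8 * `|E| ^+ 3.
Proof.
move=> Esym Esmall; apply: is_mxlog_taylor2 => //.
have /symmetric_spectral[Q [l [QQ SE]]] : (1%:M + E)^T = 1%:M + E.
  by rewrite linearD /= trmx1 Esym.
(* [mxlog] does not take its default value here: the eigenvalues lie within 1/2 of 1, so they are
   positive and a logarithm exists. *)
apply: (xgetPex 0 (P := [set H | is_mxlog (1%:M + E) H])).
exists (Q^T *m diag_mx (map_mx (@ln R) l) *m Q), Q, l; split=> // i.
have [_ /(_ i)] := diag_mx_eigen QQ SE.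
by move=> /le_trans/(_ Esmall); rewrite ler_norml; lra.
Qed.

(** * Calculus of weighted orders *)

(* [X y s = O((|y| + |s|)^k)] near 0, where [y] stands for dW and [s] for the
   square root of dt, so that both have weight 1. *)
Definition mx_order (R : realType) d k (X : R -> R -> 'M[R]_d) :=
  exists2 C : R, 0 <= C & forall y s, `|y| + `|s| <= 1 ->
    `|X y s| <= C * (`|y| + `|s|) ^+ k.

Section MxOrder.
Variables (R : realType) (d : nat).
Implicit Types X Y : R -> R -> 'M[R]_d.

Lemma eq_mx_order k X Y : (forall y s, X y s = Y y s) ->
  mx_order k Y -> mx_order k X.
Proof. by move=> XY [C C0 YC]; exists C => // y s; rewrite XY; exact: YC. Qed.

Lemma mx_orderD k X Y : mx_order k X -> mx_order k Y ->
  mx_order k (fun y s => X y s + Y y s).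
Proof.
move=> [C C0 XC] [C' C'0 YC]; exists (C + C'); first exact: addr_ge0.
move=> y s ys; rewrite (le_trans (ler_normD _ _))// mulrDl.
by apply: lerD; [exact: XC|exact: YC].
Qed.

Lemma mx_orderZ k c X : mx_order k X -> mx_order k (fun y s => c *: X y s).
Proof.
move=> [C C0 XC]; exists (`|c| * C); first exact: mulr_ge0.
by move=> y s ys; rewrite normrZ -mulrA ler_wpM2l// XC.
Qed.

Lemma mx_orderB k X Y : mx_order k X -> mx_order k Y ->
  mx_order k (fun y s => X y s - Y y s).
Proof.
move=> XC [C C0 YC]; apply: mx_orderD => //; exists C => // y s ys.
by rewrite normrN YC.
Qed.

Lemma mx_orderM k l X Y : mx_order k X -> mx_order l Y ->
  mx_order (k + l) (fun y s => X y s *m Y y s).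
Proof.
move=> [C C0 XC] [C' C'0 YC]; exists (d%:R * (C * C')).
  by rewrite !mulr_ge0.
move=> y s ys; rewrite (le_trans (mx_normM _ _))// -mulrA ler_wpM2l//.
rewrite exprD mulrACA ler_pM//; [exact: XC|exact: YC].
Qed.

Lemma mx_order_monomial a b k (K : 'M[R]_d) : (k <= a + b)%N ->
  mx_order k (fun y s => (y ^+ a * s ^+ b) *: K).
Proof.
move=> kab; exists `|K| => // y s ys.
rewrite normrZ mulrC ler_wpM2l// normrM !normrX.
have ys0 : 0 <= `|y| + `|s| by rewrite addr_ge0.
apply: (@le_trans _ _ ((`|y| + `|s|) ^+ (a + b))); last exact: ler_wiXn2l.
rewrite exprD ler_pM ?exprn_ge0// lerXn2r ?nnegrE// ?lerDl ?lerDr//.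
Qed.

End MxOrder.

(** * Pathwise expansion of the Hencky increment *)

Section HenckyExpansion.
Variables (R : realType) (d : nat) (A L : 'M[R]_d).

Let F (y s : R) := 1%:M + y *: A + s ^+ 2 *: L.
Let Da := sym_part A.
Let Du := sym_part L.
Let E (y s : R) := (F y s)^T *m F y s - 1%:M.
Let G (y s : R) := E y s - (y *+ 2) *: Da.

(** Sorted by weight: the first two terms have weight 2 and enter the claimed expansion, the last
    two have weights 3 and 4 and go to the remainder. *)
Let GE y s : G y s = (y ^+ 0 * s ^+ 2) *: (L + L^T)
  + (y ^+ 2 * s ^+ 0) *: (A^T *m A)
  + (y ^+ 1 * s ^+ 2) *: (A^T *m L + L^T *m A)
  + (y ^+ 0 * s ^+ 4) *: (L^T *m L).
Proof.
rewrite /G /E /F /Da /sym_part !linearD /= !linearZ /= trmx1.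
rewrite !(mulmxDl, mulmxDr) !mul1mx !mulmx1 -!scalemxAl.
move: (A^T) (L^T) (A^T *m A) (A^T *m L) (L^T *m A) (L^T *m L).
move=> A' L' AA AL LA LL; apply/matrixP => i j; rewrite !mxE; by field.
Qed.

Let G_order : mx_order 2 G.
Proof.
apply: (eq_mx_order GE).
by do !apply: mx_orderD; exact: mx_order_monomial.
Qed.

Let lin_order : mx_order 1 (fun y _ : R => (y *+ 2) *: Da).
Proof.
apply: (@eq_mx_order _ _ _ _ (fun y s => (y ^+ 1 * s ^+ 0) *: (2 *: Da))).
  by move=> y s; rewrite scalerA mulr1 mulr_natr.
exact: mx_order_monomial.
Qed.

Let E_order : mx_order 1 E.
Proof.
apply: (@eq_mx_order _ _ _ _ (fun y s => G y s + (y *+ 2) *: Da)).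
  by move=> y s; rewrite subrK.
apply: mx_orderD => //; case: G_order => C C0 GC; exists C => // y s ys.
apply: le_trans (GC _ _ ys) _; rewrite ler_wpM2l// ler_wiXn2l// addr_ge0//.
Qed.

(** The logarithm produces y^2 (A^T A / 2 - D_alpha^2). Writing y^2 = s^2 + (y^2 - s^2) splits this
    into a drift and the Ito term subtracted on the last line. *)
Definition hencky_remainder (y s : R) : 'M[R]_d :=
  2^-1 *: mxlog ((F y s)^T *m F y s)
  - (y *: Da + s ^+ 2 *: (Du + 2^-1 *: (A^T *m A) - Da *m Da))
  - (y ^+ 2 - s ^+ 2) *: (2^-1 *: (A^T *m A) - Da *m Da).

(** The terms of weight 1 and 2 cancel. What is left is the Taylor error of the logarithm, the two
    high-weight terms of [G], and the part of E^2 beyond 4 y^2 D_alpha^2. *)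
Let remainderE y s : hencky_remainder y s =
  2^-1 *: (mxlog (1%:M + E y s) - E y s + 2^-1 *: (E y s *m E y s))
  + 2^-1 *: ((y ^+ 1 * s ^+ 2) *: (A^T *m L + L^T *m A)
             + (y ^+ 0 * s ^+ 4) *: (L^T *m L)
             - 2^-1 *: (G y s *m E y s + (y *+ 2) *: Da *m G y s)).
Proof.
have E1 : 1%:M + E y s = (F y s)^T *m F y s by rewrite addrC subrK.
(* Expands the square without commuting factors: every piece except the last contains [g], which
   gains one weight. *)
have sqE (g e D : 'M[R]_d) (c : R) : e = g + c *: D ->
    e *m e = g *m e + c *: D *m g + c ^+ 2 *: (D *m D).
  move=> eE; rewrite {1}eE mulmxDl -addrA; congr (_ + _).
  by rewrite {1}eE mulmxDr -!scalemxAl -!scalemxAr scalerA expr2.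
have EG : E y s = G y s + (y *+ 2) *: Da by rewrite subrK.
have EE := sqE _ _ _ _ EG.
rewrite EE E1 /hencky_remainder.
move: (mxlog _) (G y s *m _) (_ *m G y s) => H GEm DG.
rewrite EG GE.
rewrite /Du /sym_part.
move: (L^T) (A^T *m A) (A^T *m L) (L^T *m A) (L^T *m L) (Da *m Da) Da.
move=> L' AA AL LA LL DD D; apply/matrixP => i j; rewrite !mxE. by field.
Qed.

Lemma hencky_remainder_bound : exists2 C : R, 0 <= C &
  forall y s, Num.min `|hencky_remainder y s| 1 <= C * (`|y| + `|s|) ^+ 3.
Proof.
have [C1 C1_ge0 E1] := E_order.
pose X y s := (y ^+ 1 * s ^+ 2) *: (A^T *m L + L^T *m A)
   + (y ^+ 0 * s ^+ 4) *: (L^T *m L)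
   - 2^-1 *: (G y s *m E y s + (y *+ 2) *: Da *m G y s).
have [C2 C2_ge0 X3] : mx_order 3 X.
  apply: mx_orderB; first by apply: mx_orderD; exact: mx_order_monomial.
  apply: mx_orderZ; apply: mx_orderD.
    exact: (mx_orderM G_order E_order).
  exact: (mx_orderM lin_order G_order).
(* [N] is chosen so that 2 N r <= 1 yields both r <= 1, where the order bounds apply, and d^2 |E| <=
   1/2, where the logarithm bound applies. Otherwise (2 N r)^3 already exceeds 1. *)
pose N : R := d%:R ^+ 2 * C1 + 1.
have N_gt0 : 0 < N by rewrite ltr_wpDl// mulr_ge0// exprn_ge0.
pose C3 := 2 * d%:R ^+ 8 * C1 ^+ 3 + C2.
have C3_ge0 : 0 <= C3.
  by rewrite addr_ge0// mulr_ge0 ?exprn_ge0// mulr_ge0// exprn_ge0.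
have N3_ge0 : 0 <= (2 * N) ^+ 3 by rewrite exprn_ge0// mulr_ge0// ltW.
exists (C3 + (2 * N) ^+ 3); first exact: addr_ge0.
move=> y s; set r := `|y| + `|s|.
have r_ge0 : 0 <= r by rewrite addr_ge0.
have [rN|Nr] := leP (2 * N * r) 1; last first.
  rewrite ge_min; apply/orP; right.
  rewrite mulrDl -exprMn (le_trans (exprn_ege1 3 (ltW Nr)))//.
  by rewrite lerDr mulr_ge0// exprn_ge0.
have r1 : r <= 1.
  rewrite (le_trans _ rN)// ler_peMl// /N.
  have : 0 <= d%:R ^+ 2 * C1 by rewrite mulr_ge0// exprn_ge0.
  lra.
have E_le := E1 y s r1; rewrite -/r expr1 in E_le.
rewrite ge_min; apply/orP; left.
rewrite remainderE -/(X y s).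
have Esym : (E y s)^T = E y s by rewrite linearB /= trmx_mul trmxK trmx1.
have Esmall : d%:R ^+ 2 * `|E y s| <= 1 / 2.
  have : d%:R ^+ 2 * `|E y s| <= d%:R ^+ 2 * (C1 * r).
    by rewrite ler_wpM2l// exprn_ge0.
  by move: rN; rewrite /N; nra.
have T := mxlog_taylor2 Esym Esmall.
have T' : 2 * d%:R ^+ 8 * `|E y s| ^+ 3 <= 2 * d%:R ^+ 8 * C1 ^+ 3 * r ^+ 3.
  rewrite -[leRHS]mulrA ler_wpM2l ?mulr_ge0 ?exprn_ge0// -exprMn.
  by rewrite lerXn2r ?nnegrE// mulr_ge0.
have X_le := X3 y s r1; rewrite -/r in X_le.
have r3 : 0 <= r ^+ 3 by rewrite exprn_ge0.
have N3 : 0 <= (2 * N) ^+ 3 * r ^+ 3 by rewrite mulr_ge0.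
apply: le_trans (ler_normD _ _) _; rewrite !normrZ ger0_norm ?invr_ge0//.
rewrite mulrDl {1}/C3 mulrDl.
have := normr_ge0 (X y s).
have := normr_ge0 (mxlog (1%:M + E y s) - E y s + 2^-1 *: (E y s *m E y s)).
lra.
Qed.

End HenckyExpansion.

(** * Gaussian integrals and the o(dt) criterion *)

(* No measurability is needed: the integral of a nonnegative function is the
   supremum over the simple functions below it. *)
Lemma ge0_le_integralT d (T : measurableType d) (R : realType)
    (mu : {measure set T -> \bar R}) (D : set T) (f g : T -> \bar R) :
  (forall x, D x -> 0 <= f x)%E -> (forall x, 0 <= g x)%E ->
  (forall x, D x -> f x <= g x)%E ->
  (\int[mu]_(x in D) f x <= \int[mu]_x g x)%E.
Proof.
move=> f0 g0 fg; rewrite integral_mkcond.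
rewrite !ge0_integralTE//; last by move=> x; exact: erestrict_ge0.
apply: le_ereal_sup => _ /= [k kf <-]; exists k => // x.
apply: (le_trans (kf x)); rewrite /patch; case: ifPn => // /set_mem; exact: fg.
Qed.

(** The Radon-Nikodym derivative with respect to Lebesgue measure equals [normal_pdf] almost
    everywhere, because both have the same integral over every measurable set. *)
Lemma integral_normal_prob (R : realType) (m s : R)
    (f : measurableTypeR R -> \bar R) :
  (forall x, 0 <= f x)%E -> measurable_fun [set: R] f ->
  (\int[normal_prob m s]_x f x =
   \int[lebesgue_measure]_x (f x * (normal_pdf m s x)%:E))%E.
Proof.
move=> f0 mf; have dom := normal_prob_dominates m s.
rewrite -(Radon_Nikodym_SigmaFinite.change_of_variables dom)//.
apply: ge0_ae_eq_integral => //=.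
- apply: emeasurable_funM => //.
  exact: measurable_int (Radon_Nikodym_SigmaFinite.f_integrable dom).
- apply: emeasurable_funM => //.
  apply/measurable_EFinP; exact: measurable_normal_pdf.
- by move=> x _; rewrite mule_ge0// Radon_Nikodym_SigmaFinite.f_ge0.
- by move=> x _; rewrite mule_ge0// lee_fin normal_pdf_ge0.
- apply: ae_eqe_mul2l => /=.
  apply: integral_ae_eq => //=.
  + exact: Radon_Nikodym_SigmaFinite.f_integrable.
  + by apply/measurable_EFinP; exact: measurable_normal_pdf.
  + by move=> E _ mE; rewrite -Radon_Nikodym_SigmaFinite.f_integral.
Qed.

(* The density of N(0, s^2) times exp (y^2 / (4 s^2)) is sqrt 2 times the density
   of N(0, 2 s^2). *)
Lemma normal_prob_expR_sqr (R : realType) (s : R) : 0 < s ->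
  (\int[normal_prob 0 s]_y (expR ((y / s) ^+ 2 / 4))%:E = (Num.sqrt 2)%:E)%E.
Proof.
move=> s0; have s_neq0 : s != 0 by rewrite gt_eqF.
have r_neq0 : Num.sqrt 2 * s != 0 by rewrite mulf_neq0 ?sqrtr_eq0 -?ltNge.
have mexp : measurable_fun [set: R] (fun y : R => (expR ((y / s) ^+ 2 / 4))%:E).
  apply/measurable_EFinP; apply: measurableT_comp => //.
  apply: measurable_funM => //; apply: measurable_funX.
  exact: measurable_funM.
rewrite integral_normal_prob//.
transitivity (\int[lebesgue_measure]_x
    ((Num.sqrt 2)%:E * (normal_pdf 0 (Num.sqrt 2 * s) x)%:E) : \bar R)%E.
  apply: eq_integral => x _; rewrite -!EFinM; congr EFin.
  rewrite !normal_pdfE// /normal_peak /normal_fun subr0.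
  have -> : (Num.sqrt 2 * s) ^+ 2 = 2 * s ^+ 2 :> R by rewrite exprMn sqr_sqrtr.
  have -> : Num.sqrt (2 * s ^+ 2 * pi *+ 2) =
      Num.sqrt 2 * Num.sqrt (s ^+ 2 * pi *+ 2).
    by rewrite -sqrtrM//; congr Num.sqrt; ring.
  rewrite invfM.
  rewrite [in RHS]mulrA mulVKf ?sqrtr_eq0 -?ltNge//.
  rewrite mulrCA -expRD; congr (_ * expR _); field.
  by rewrite s_neq0.
rewrite ge0_integralZl//.
- by rewrite integral_normal_pdf mule1.
- by apply/measurable_EFinP; exact: measurable_normal_pdf.
- by move=> x _; rewrite lee_fin normal_pdf_ge0.
Qed.

(** The cube is at most the fourth power, (|z| + 1)^2 <= 2 z^2 + 2 <= 32 (1 + z^2 / 16), and 1 + x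
    <= exp x is squared. *)
Lemma cube_le_expR (R : realType) (z : R) :
  (`|z| + 1) ^+ 3 <= 32 ^+ 2 * expR (z ^+ 2 / 4).
Proof.
have z1 : 1 <= `|z| + 1 by rewrite lerDr.
apply: (@le_trans _ _ ((`|z| + 1) ^+ 4)); first by rewrite ler_weXn2l.
have ez : (1 + z ^+ 2 / 16) ^+ 2 <= expR (z ^+ 2 / 4).
  have -> : z ^+ 2 / 4 = z ^+ 2 / 8 + z ^+ 2 / 8 by field.
  apply: (@le_trans _ _ (expR (z ^+ 2 / 16) ^+ 2)).
    rewrite lerXn2r ?nnegrE ?expR_ge0 ?expR_ge1Dx//.
    by have := sqr_ge0 z; lra.
  rewrite expr2 -expRD ler_expR; have := sqr_ge0 z; lra.
apply: (@le_trans _ _ (32 ^+ 2 * (1 + z ^+ 2 / 16) ^+ 2)).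
  rewrite -exprMn (exprM (`|z| + 1) 2 2) lerXn2r ?nnegrE ?sqr_ge0//.
    by rewrite mulr_ge0// addr_ge0// divr_ge0// sqr_ge0.
  rewrite -(real_normK (num_real z)); have := normr_ge0 z.
  by move: `|z| => x x0; have := sqr_ge0 (x - 1); lra.
by rewrite ler_wpM2l// sqr_ge0.
Qed.

Lemma integral_law (R : realType) (disp disp' : measure_display)
    (T : measurableType disp) (T' : measurableType disp') (P : probability T R)
    (Q : {measure set T' -> \bar R}) (X : T -> T') (f : T' -> \bar R) :
  measurable_fun [set: T] X ->
  (forall B, measurable B -> P [set w | B (X w)] = Q B) ->
  measurable_fun [set: T'] f -> (forall y, 0 <= f y)%E ->
  (\int[P]_w (f \o X) w = \int[Q]_y f y)%E.
Proof.
move=> mX lawX mf f0.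
pose Y : {mfun T >-> T'} := HB.pack X (isMeasurableFun.Build _ _ _ _ _ mX).
rewrite -(@ge0_integral_distribution _ _ _ _ _ P Y _ mf f0).
by apply: eq_measure_integral => B mB _; exact: lawX.
Qed.

(** With s = sqrt h and z = dW / s, the bound reads C s^3 (|z| + 1)^3, whose expectation is O(s^3)
    because z is standard Gaussian; divided by h = s^2 it is O(s). Integrating over the whole space
    instead of [D h] only enlarges it. *)
Lemma is_o_dt_cubic (R : realType) (disp : measure_display)
    (T : measurableType disp) (P : probability T R) (d : nat)
    (dW : R -> T -> R) (D : R -> set T) (X : R -> T -> 'M[R]_d) (C : R) :
  (forall h, 0 < h -> measurable_fun [set: T] (dW h)) ->
  (forall h, 0 < h -> forall B : set R, measurable B ->
     P [set w | B (dW h w)] = normal_prob 0 (Num.sqrt h) B) ->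
  0 <= C ->
  (forall h w, 0 < h ->
     Num.min `|X h w| 1 <= C * (`|dW h w| + Num.sqrt h) ^+ 3) ->
  is_o_dt P D X.
Proof.
move=> mdW ldW C0 XC; rewrite /is_o_dt.
(* 32^2 comes from [cube_le_expR], and sqrt 2 is the Gaussian integral of exp (z^2 / 4). *)
pose K : R := C * 32 ^+ 2 * Num.sqrt 2.
have bound h : 0 < h ->
    (\int[P]_(w in D h) (Num.min `|X h w| 1)%:E <= (K * Num.sqrt h * h)%:E)%E.
  move=> h0; have s0 : 0 < Num.sqrt h by rewrite sqrtr_gt0.
  set s := Num.sqrt h in s0 *.
  have hE : h = s ^+ 2 by rewrite sqr_sqrtr// ltW.
  pose c := C * 32 ^+ 2 * s ^+ 3.
  have c0 : 0 <= c
    by rewrite mulr_ge0 ?exprn_ge0 ?(ltW s0)// mulr_ge0// sqr_ge0.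
  pose g (y : R) : \bar R := (expR ((y / s) ^+ 2 / 4))%:E.
  have mg : measurable_fun [set: R] g.
    apply/measurable_EFinP; apply: measurableT_comp => //.
    apply: measurable_funM => //; apply: measurable_funX.
    exact: measurable_funM.
  have g0 y : (0 <= g y)%E by rewrite lee_fin expR_ge0.
  apply: (@le_trans _ _ (\int[P]_w (c%:E * (g \o dW h) w))%E).
    apply: ge0_le_integralT => [w _|w|w _].
    - by rewrite lee_fin le_min normr_ge0 ler01.
    - by rewrite mule_ge0// lee_fin.
    - rewrite -EFinM lee_fin (le_trans (XC h w h0))//.
      have -> : `|dW h w| + s = s * (`|dW h w / s| + 1).
        rewrite normrM normfV (gtr0_norm s0); field; exact: lt0r_neq0.
      have -> : c * expR ((dW h w / s) ^+ 2 / 4) =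
          C * (s ^+ 3 * (32 ^+ 2 * expR ((dW h w / s) ^+ 2 / 4))).
        by rewrite /c; ring.
      rewrite exprMn ler_wpM2l// ler_wpM2l ?exprn_ge0 ?(ltW s0)//.
      exact: cube_le_expR.
  rewrite ge0_integralZl//; last 2 first.
  - exact/(measurableT_comp mg)/mdW.
  - by move=> w _; exact: g0.
  rewrite (integral_law (Q := normal_prob 0 s) (mdW h h0) (ldW h h0))//.
  rewrite normal_prob_expR_sqr// -EFinM lee_fin.
  by have -> : K * s * h = c * Num.sqrt 2 by rewrite /K /c hE; ring.
apply: (@squeeze_cvge _ _ _ _ (cst 0%E) _ (fun h => (K * Num.sqrt h)%:E)).
- near=> h; have h0 : 0 < h by near: h; exact: nbhs_right_gt.
  apply/andP; split.
    rewrite mule_ge0 ?lee_fin ?invr_ge0 ?(ltW h0)//.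
    by apply: integral_ge0 => w _; rewrite lee_fin le_min normr_ge0 ler01.
  apply: le_trans (lee_wpmul2l _ (bound h h0)) _.
    by rewrite lee_fin invr_ge0 ltW.
  by rewrite -EFinM lee_fin mulrC mulfK// gt_eqF.
- exact: cvg_cst.
- apply: cvg_EFin; first exact: nearW.
  rewrite -[X in _ --> X](mulr0 K); apply: cvgMr.
  rewrite -[X in _ --> X](sqrtr0 R); apply: cvg_at_right_filter.
  exact: sqrt_continuous.
Unshelve. all: by end_near.
Qed.

(** * Stochastic Hencky increments and their quadratic drift corrections *)

Theorem theorem2p1 (R : realType) (d : nat) (disp : measure_display)
    (T : measurableType disp) (P : probability T R) (W : R -> T -> R)
    (u alpha : 'rV[R]_d -> R -> 'rV[R]_d)
    (hW : brownian_motion P W)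
    (hu : forall (x : 'rV[R]_d) (t : R), differentiable (fun y => u y t) x)
    (halpha : forall (x : 'rV[R]_d) (t : R), differentiable (fun y => alpha y t) x)
    (x : 'rV[R]_d) (t : R) (ht : 0 <= t) :
  let L := grad (fun y => u y t) x in
  let A := grad (fun y => alpha y t) x in
  let Du := sym_part L in
  let Da := sym_part A in
  let Wa := skew_part A in
  let dW := fun (h : R) (w : T) => W (t + h) w - W t w in
  let F := fun (h : R) (w : T) => 1%:M + dW h w *: A + h *: L in
  let oriented := fun h : R => [set w | 0 < \det (F h w)] in
  let dH := fun (h : R) (w : T) => 2^-1 *: mxlog ((F h w)^T *m F h w) in
  let dh := fun (h : R) (w : T) => 2^-1 *: mxlog (F h w *m (F h w)^T) in
  let QH := 2^-1 *: (A^T *m A) - Da *m Da in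
  let Qh := 2^-1 *: (A *m A^T) - Da *m Da in
  [/\ eq_through_dt P dW oriented dH
        Da (Du + 2^-1 *: (A^T *m A) - Da *m Da),
      eq_through_dt P dW oriented dh
        Da (Du + 2^-1 *: (A *m A^T) - Da *m Da),
      Qh - QH = 2^-1 *: (A *m A^T - A^T *m A) /\
      2^-1 *: (A *m A^T - A^T *m A) = Wa *m Da - Da *m Wa,
      (Qh - QH)^T = Qh - QH /\ \tr (Qh - QH) = 0 &
      A *m A^T = A^T *m A -> Qh - QH = 0].
Proof.
(* [grad] hides a transpose, on which rewriting would otherwise diverge. *)
move=> L A; clearbody L A => Du Da Wa dW F oriented dH dh QH Qh.
have mdW h : 0 < h -> measurable_fun [set: T] (dW h).
  move=> h0; apply: measurable_funB; apply: bm_measurable hW _ _ => //.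
  by rewrite addr_ge0// ltW.
have ldW h : 0 < h -> forall B : set R, measurable B ->
    P [set w | B (dW h w)] = normal_prob 0 (Num.sqrt h) B.
  move=> h0 B mB; have th : t < t + h by rewrite ltrDl.
  have := bm_gaussian hW ht th mB.
  by rewrite addrAC subrr add0r.
(* Stated for arbitrary gradients, so as to serve for (A, L) and for (A^T, L^T) on the same events
   [oriented]. *)
have expansion (A' L' : 'M[R]_d) X :
    (forall h w, X h w = 2^-1 *:
       mxlog ((1%:M + dW h w *: A' + h *: L')^T *m
              (1%:M + dW h w *: A' + h *: L'))) ->
    eq_through_dt P dW oriented X (sym_part A')
      (sym_part L' + 2^-1 *: (A'^T *m A') - sym_part A' *m sym_part A').
  move=> XE; have [C C0 bound] := hencky_remainder_bound A' L'.
  (* Only dW dW - dt needs a coefficient: dW dt and dt dt have weights 3 and 4 and are absorbed in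
     the cubic remainder. *)
  exists (2^-1 *: (A'^T *m A') - sym_part A' *m sym_part A'), 0, 0.
  apply: (@is_o_dt_cubic _ _ _ _ _ dW oriented _ C mdW ldW C0) => h w h0.
  have := bound (dW h w) (Num.sqrt h).
  rewrite /hencky_remainder sqr_sqrtr ?(ltW h0)// (ger0_norm (sqrtr_ge0 h)).
  by rewrite XE !scaler0 !addr0 -expr2.
have sym_tr (M : 'M[R]_d) : sym_part M^T = sym_part M.
  by rewrite /sym_part trmxK addrC.
have Qdiff : Qh - QH = 2^-1 *: (A *m A^T - A^T *m A).
  by rewrite /Qh /QH opprB addrA subrK scalerBr.
have commutator : 2^-1 *: (A *m A^T - A^T *m A) = Wa *m Da - Da *m Wa.
  rewrite /Wa /Da /skew_part /sym_part -!scalemxAl -!scalemxAr !scalerA.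
  rewrite !mulmxDl !mulmxDr !mulNmx !mulmxN.
  (* With the four products as atoms, the identity becomes linear in each entry. *)
  move: (A *m A) (A *m A^T) (A^T *m A) (A^T *m A^T) => M1 M2 M3 M4.
  by apply/matrixP => i j; rewrite !mxE; field.
split.
- exact: expansion.
- have FT h w : (F h w)^T = 1%:M + dW h w *: A^T + h *: L^T.
    by rewrite /F !linearD /= !linearZ /= trmx1.
  have := expansion A^T L^T dh; rewrite !sym_tr trmxK => expansionT.
  by apply: expansionT => h w; rewrite -FT trmxK.
- by [].
- rewrite Qdiff; split.
    by rewrite linearZ linearB /= !trmx_mul trmxK.
  by rewrite mxtraceZ linearB /= mxtrace_mulC subrr mulr0.
- by move=> An; rewrite Qdiff An subrr scaler0.
Qed.
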